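(* Let $\mathcal B_i$ be a set of bidders whose valuations are all gross substitute. Then for every price vector $r\ge0$, the demand $D_i(r)$ of an EF-mediator for $\mathcal B_i$ equals the demand $D_{\mathrm{OR}}(r)$ of the OR-player for $\mathcal B_i$. Moreover, for a set $S$ in this demand, the allocation computed in the virtual auction of the EF-mediator for $S$ and reserve prices $r$ is an optimal allocation for the OR-player for $S$, and vice versa (an optimal allocation of $S$ for the OR-player can be used by the EF-mediator as her virtual-auction allocation for $S$ and $r$, maximizing her revenue).
   Context: Let $\Omega$ be a finite set of items; price vectors are $p\in\mathbb{R}_{\ge0}^\Omega$, $p(S)=\sum_{j\in S}p_j$, comparisons item-wise. Each bidder $b$ has a monotone valuation $v_b:2^\Omega\to\mathbb{R}$, $v_b(\emptyset)=0$; $D_b(p)$ is the set of $S\subseteq\Omega$ maximizing $v_b(S)-p(S)$. A valuation is gross substitute if for all price vectors $p^{(2)}\ge p^{(1)}\ge 0$ and every $D^{(1)}\in D(p^{(1)})$ there is $D^{(2)}\in D(p^{(2)})$ containing every $j\in D^{(1)}$ with $p^{(1)}_j=p^{(2)}_j$. An allocation of $T\subseteq\Omega$ to bidders $\mathcal B_i$ is a family of pairwise disjoint subsets $\langle T_b\rangle_{b\in\mathcal B_i}$ of $T$; it is envy free on $T$ at $p$ if each $T_b$ maximizes $v_b(\cdot)-p(\cdot)$ over subsets of $T$. EF-mediator for $\mathcal B_i$ at prices $r\ge0$: for every $S\subseteq\Omega$ a virtual auction computes a minimal (no item-wise smaller vector has the property) price vector $p^S\ge r$ that is envy free on $S$ for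 $\mathcal B_i$, with an envy-free allocation $\langle S_b\rangle$ of $S$ at $p^S$ maximizing $\sum_b p^S(S_b)$ among such allocations; set $p^S_j=r_j$ for $j\notin S$. Revenue $R_{i,r}(S)=\sum_b p^S(S_b)-r(S)$ if $S_b\in D_b(p^S)$ for all $b\in\mathcal B_i$, else $-1$. Demand $D_i(r)$ = set of maximizers of $R_{i,r}$. OR-player for $\mathcal B_i$: valuation $v_{\mathrm{OR}}(S)=\max\sum_{b\in\mathcal B_i}v_b(S_b)$ over allocations $\langle S_b\rangle$ of $S$; an allocation attaining this maximum is an optimal allocation for $S$. Her demand $D_{\mathrm{OR}}(r)$ is the set of $S$ maximizing $v_{\mathrm{OR}}(S)-r(S)$. *)

(* Defs.v *)
From HB Require Import structures.
From mathcomp Require Import all_boot all_order all_algebra.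
From mathcomp Require Import reals.
Set Implicit Arguments. Unset Strict Implicit. Unset Printing Implicit Defensive.
Import Order.TTheory GRing.Theory Num.Theory.
Local Open Scope ring_scope.

Section Auction.
Variables (R : realType) (Omega B : finType).

Definition price (p : Omega -> R) (S : {set Omega}) : R := \sum_(j in S) p j.

Definition nonneg_prices (p : Omega -> R) : Prop := forall j, 0 <= p j.

Definition price_le (p q : Omega -> R) : Prop := forall j, p j <= q j.

Definition monotone_val (v : {set Omega} -> R) : Prop :=
  forall S T : {set Omega}, S \subset T -> v S <= v T.

Definition in_demand (v : {set Omega} -> R) (p : Omega -> R) (S : {set Omega}) : bool :=
  [forall T : {set Omega}, v T - price p T <= v S - price p S].

Definition gross_substitute (v : {set Omega} -> R) : Prop :=
  forall p1 p2 : Omega -> R, nonneg_prices p1 -> price_le p1 p2 ->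
  forall D1, in_demand v p1 D1 ->
  exists2 D2, in_demand v p2 D2 &
    forall j, j \in D1 -> p1 j = p2 j -> j \in D2.

Definition is_alloc (T : {set Omega}) (A : B -> {set Omega}) : bool :=
  [forall b, A b \subset T] &&
  [forall b, forall b', (b != b') ==> [disjoint A b & A b']].

Definition envy_free (v : B -> {set Omega} -> R) (T : {set Omega})
    (p : Omega -> R) (A : B -> {set Omega}) : Prop :=
  is_alloc T A /\
  forall b (U : {set Omega}), U \subset T ->
    v b U - price p U <= v b (A b) - price p (A b).

Definition has_ef_alloc v T p : Prop := exists A, envy_free v T p A.

Definition virtual_auction (v : B -> {set Omega} -> R) (r : Omega -> R)
    (S : {set Omega}) (p : Omega -> R) (A : B -> {set Omega}) : Prop :=
  [/\ price_le r p, has_ef_alloc v S p,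
      (forall q, price_le r q -> price_le q p -> has_ef_alloc v S q -> q = p),
      (forall j, j \notin S -> p j = r j) &
      (envy_free v S p A /\
      forall A', envy_free v S p A' ->
         \sum_b price p (A' b) <= \sum_b price p (A b))].

Definition revenue (v : B -> {set Omega} -> R) (r : Omega -> R)
    (S : {set Omega}) (p : Omega -> R) (A : B -> {set Omega}) : R :=
  if [forall b, in_demand (v b) p (A b)]
  then \sum_b price p (A b) - price r S else -1.

(* S \in D_i(r) for the EF-mediator whose virtual auction returns
   (pS S, AS S) for each S *)
Definition mediator_demand v r (pS : {set Omega} -> Omega -> R)
    (AS : {set Omega} -> B -> {set Omega}) (S : {set Omega}) : Prop :=
  forall T, revenue v r T (pS T) (AS T) <= revenue v r S (pS S) (AS S).

(* OR-player valuation: max over allocations of S of sum_b v_b(S_b).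
   The empty allocation has value 0, so starting the max at 0 is harmless. *)
Definition v_OR (v : B -> {set Omega} -> R) (S : {set Omega}) : R :=
  \big[Num.max/0]_(A : {ffun B -> {set Omega}} | is_alloc S A)
     \sum_b v b (A b).

Definition OR_optimal v S (A : B -> {set Omega}) : Prop :=
  is_alloc S A /\ \sum_b v b (A b) = v_OR v S.

Definition OR_demand v (r : Omega -> R) (S : {set Omega}) : Prop :=
  forall T, v_OR v T - price r T <= v_OR v S - price r S.

End Auction.

(* Main.v *)
(* By linear programming duality, prices p >= r support an allocation of S of
   maximal surplus (value minus reserve prices) in which every item with
   p j > r j is sold iff the Lyapunov function (the sum of the indirect
   utilities at p plus p(S) - r(S)) equals this surplus; call such p tight.
   Gross substitutes makes indirect utilities submodular, so if p is envy free
   then replacing q by the meet of p and q does not increase the Lyapunov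
   function.  A Kelso-Crawford auction with increment e yields prices that are
   tight up to O(e); taking their meet with p and minimizing over the compact
   box [r, p], one finds tight prices below every envy-free p.  Hence the
   minimal envy-free prices of a virtual auction are tight.

   Let y be the prices of the virtual auction for all items.  For a set S that
   carries the whole maximal surplus, in particular when S is an OR-demand or
   when S has a revenue other than -1, the minimal prices for S are y itself,
   with y = r outside S.  The revenue of S is then at most
   y(S) - r(S) = y(Omega) - r(Omega), with equality iff everything that has a
   positive price in S is sold, which holds exactly for the OR-demand. *)
Require Import Defs.
From HB Require Import structures.
From mathcomp Require Import boolp classical_sets topology normedtype derive.
(* After classical_sets, so that set0, setT, ... denote finite sets. *)
From mathcomp Require Import all_boot all_order all_algebra.
From mathcomp Require Import reals lra.
Import Order.TTheory GRing.Theory Num.Theory.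
Import numFieldNormedType.Exports.
Local Open Scope ring_scope.

Set Implicit Arguments. Unset Strict Implicit. Unset Printing Implicit Defensive.

(** * Minimum of a Lipschitz function over a box of prices *)

Lemma lipschitz_box_min (R : realType) (I : finType) (f : (I -> R) -> R) (C : nat)
    (a b : I -> R) :
  (forall e x y, 0 <= e -> (forall j, y j <= x j + e) ->
     (forall j, x j <= y j + e) -> f x <= f y + e *+ C) ->
  (forall j, a j <= b j) ->
  exists2 c, (forall j, a j <= c j <= b j) &
    forall x, (forall j, a j <= x j <= b j) -> f c <= f x.
Proof.
move=> f_lip ab.
pose T := prod_topology (fun _ : I => R : topologicalType).
pose box : set T := [set x : T | forall j, `[a j, b j]%classic (x j)]%classic.
have box_compact : compact box.
  apply: (@tychonoff I (fun=> R : topologicalType) (fun j => `[a j, b j]%classic)) => j.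
  exact: segment_compact.
have box0 : (box !=set0)%classic.
  by exists a => j /=; rewrite in_itv /= lexx ab.
have f_cont : continuous (f : T -> R).
  move=> x; apply: (@cvgrPdist_le R R T (nbhs x) _ f (f x)).2 => e e_gt0.
  (* The successor keeps the divisor nonzero when [C] is 0. *)
  pose d := e / C.+1%:R.
  have d_gt0 : 0 < d by rewrite divr_gt0.
  have dC : d *+ C <= e.
    have -> : e = d *+ C.+1 by rewrite -mulr_natr divfK ?pnatr_eq0.
    exact: (ler_wpMn2l (ltW d_gt0) (leqnSn C)).
  have near_x : \forall t \near x, forall j, `|x j - t j| <= d.
    apply: (@filter_forall T I (fun j t => `|x j - t j| <= d) (nbhs x) _) => j.
    apply: (@cvgrPdist_le R R T (nbhs x) _ (fun t => t j) (x j)).1 d_gt0.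
    exact: (@proj_continuous I (fun=> R : topologicalType) j x).
  near=> t.
  have xt_near : forall j, `|x j - t j| <= d by near: t.
  have xt j : x j <= t j + d by have := xt_near j; rewrite ler_norml; lra.
  have tx j : t j <= x j + d by have := xt_near j; rewrite ler_norml; lra.
  have := f_lip d x t (ltW d_gt0) tx xt; have := f_lip d t x (ltW d_gt0) xt tx.
  by rewrite ler_norml; lra.
have [c c_box c_min] :=
  compact_EVT_min box0 box_compact (continuous_subspaceT f_cont).
exists c => [j|x x_box].
  by move: c_box; rewrite in_setE => /(_ j); rewrite /= in_itv.
by apply: c_min; rewrite in_setE => j; rewrite /= in_itv; exact: x_box.
Unshelve. all: by end_near. Qed.

(** * Prices and indirect utilities *)

Section Price.
Variables (R : realType) (Omega : finType).
Implicit Types (p q : Omega -> R) (S T : {set Omega}) (v : {set Omega} -> R).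

(** The index [i0] of value 0 turns the default of the maximum into a genuine value. *)
Lemma bigmax0_attained (I : finType) (P : pred I) (F : I -> R) i0 :
  P i0 -> F i0 = 0 ->
  exists2 i, P i & \big[Num.max/0]_(i | P i) F i = F i.
Proof.
move=> Pi0 Fi0.
have : \big[Num.max/0]_(i | P i) F i = 0 \/
    exists2 i, P i & \big[Num.max/0]_(i | P i) F i = F i.
  elim/big_ind: _ => [|x y IHx IHy|i Pi]; [by left| |by right; exists i].
  by rewrite /Num.max; case: ifP.
by case=> // ->; exists i0.
Qed.

Lemma price0 p : price p set0 = 0.
Proof. by rewrite /price big_set0. Qed.

Lemma price_mono p q T : (forall j, j \in T -> p j <= q j) ->
  price p T <= price q T.
Proof. exact: ler_sum. Qed.

Lemma price_eq p q T : (forall j, j \in T -> p j = q j) -> price p T = price q T.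
Proof. exact: eq_bigr. Qed.

Lemma price_ge0 p T : nonneg_prices p -> 0 <= price p T.
Proof. by move=> p_ge0; apply: sumr_ge0. Qed.

Lemma price_sub p S T : nonneg_prices p -> S \subset T -> price p S <= price p T.
Proof.
move=> p_ge0 /setIidPr ST; rewrite /price [leRHS](big_setID S) /= ST lerDl.
exact: sumr_ge0.
Qed.

Lemma priceB p q T : price (fun j => p j - q j) T = price p T - price q T.
Proof. exact: sumrB. Qed.

Lemma priceD p q T : price (fun j => p j + q j) T = price p T + price q T.
Proof. exact: big_split. Qed.

Definition unit_price (j : Omega) (t : R) (i : Omega) : R :=
  if i == j then t else 0.

Lemma price_unit j t T : price (unit_price j t) T = if j \in T then t else 0.
Proof.
rewrite /price -big_mkcondr /=; case: ifP => jT.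
  rewrite (bigD1 j) ?jT ?eqxx //= big1 ?addr0 // => i.
  by case: (i =P j); rewrite ?andbF.
by rewrite big1 // => i /andP[iT /eqP ij]; rewrite -ij iT in jT.
Qed.

(** The indirect utility of a bidder restricted to [S]. The default 0 is the value of the empty
    bundle once [v set0 = 0]. *)
Definition utility v S p : R :=
  \big[Num.max/0]_(T : {set Omega} | T \subset S) (v T - price p T).

Definition demand_within v S p (D : {set Omega}) : Prop :=
  D \subset S /\
  forall U : {set Omega}, U \subset S -> v U - price p U <= v D - price p D.

Lemma in_demandP v p D : reflect (demand_within v setT p D) (in_demand v p D).
Proof.
apply: (iffP forallP) => [D_dem | [_ D_dem] U]; last exact/D_dem/subsetT.
by split=> [|U _]; [exact: subsetT | exact: D_dem].
Qed.

Lemma utility_ge v S p T : T \subset S -> v T - price p T <= utility v S p.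
Proof. by move=> TS; apply: le_bigmax_cond. Qed.

Lemma eq_utility v S p q : (forall j, j \in S -> p j = q j) ->
  utility v S p = utility v S q.
Proof.
move=> pq; apply: eq_bigr => T /subsetP TS; congr (_ - _).
by apply: price_eq => j /TS; exact: pq.
Qed.

Section Valuation.
Variables (v : {set Omega} -> R) (S : {set Omega}).
Hypothesis v0 : v set0 = 0.

Lemma utility_attained p :
  exists2 D : {set Omega}, D \subset S & utility v S p = v D - price p D.
Proof. by apply: (@bigmax0_attained _ _ _ set0); rewrite ?sub0set // v0 price0 subrr. Qed.

Lemma utility_demand p (D : {set Omega}) :
  demand_within v S p D <-> D \subset S /\ utility v S p = v D - price p D.
Proof.
split=> [] [DS D_opt]; split=> //; last first.
  by move=> U US; rewrite -D_opt; exact: utility_ge.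
apply/eqP; rewrite eq_le utility_ge // andbT.
by have [U US ->] := utility_attained p; exact: D_opt.
Qed.

Lemma demand_exists p : exists D, demand_within v S p D.
Proof. by have [D DS Dopt] := utility_attained p; exists D; apply/utility_demand. Qed.

Lemma utility_antimono p q : (forall j, j \in S -> p j <= q j) ->
  utility v S q <= utility v S p.
Proof.
move=> pq; have [D DS ->] := utility_attained q.
apply: le_trans (utility_ge v p DS); rewrite lerD2l lerN2.
by apply: price_mono => j jD; exact/pq/(subsetP DS).
Qed.

Lemma utility_lipschitz p q e : 0 <= e -> (forall j, q j <= p j + e) ->
  utility v S p <= utility v S q + e *+ #|Omega|.
Proof.
move=> e_ge0 qp; have [D DS ->] := utility_attained p.
have := utility_ge v q DS.
suff : price q D <= price p D + e *+ #|Omega| by lra.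
apply: (le_trans (price_mono (q := fun j => p j + e) _)) => //.
rewrite priceD lerD2l; apply: le_trans (price_sub _ (subsetT D)) _ => //.
by rewrite /price sumr_const cardsT.
Qed.

(** * Gross substitutes and submodularity of the indirect utility *)

Definition substitutes_within : Prop :=
  forall p1 p2 : Omega -> R, nonneg_prices p1 -> price_le p1 p2 ->
  forall D1, demand_within v S p1 D1 ->
  exists2 D2, demand_within v S p2 D2 &
    forall j, j \in D1 -> p1 j = p2 j -> j \in D2.

Hypothesis v_gs : substitutes_within.

(* With s the utility lost by raising the price of j by t, a bundle D demanded
   at x is still demanded once j costs s more; if D contains j, substitutes
   carry j over to a bundle demanded at p plus s on j, so p also loses s. *)
Lemma utility_drop_unit x p j t :
  nonneg_prices x -> price_le x p -> x j = p j -> 0 <= t ->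
  utility v S x - utility v S (fun i => x i + unit_price j t i) <=
  utility v S p - utility v S (fun i => p i + unit_price j t i).
Proof.
move=> x_ge0 xp xpj t_ge0.
set s := utility v S x - _.
have up_drop (y : Omega -> R) t1 t2 : t1 <= t2 ->
    utility v S (fun i => y i + unit_price j t2 i) <=
    utility v S (fun i => y i + unit_price j t1 i).
  move=> t12; apply: utility_antimono => i _; rewrite lerD2l /unit_price.
  by case: ifP.
have [s_gt0|s_le0] := ltP 0 s; last first.
  apply: le_trans s_le0 _; rewrite subr_ge0; apply: utility_antimono => i _.
  by rewrite lerDl /unit_price; case: ifP.
have [D DS Dopt] := utility_attained x.
have jD : j \in D.
  apply/negPn/negP => jD; move: s_gt0; rewrite /s Dopt.
  have := utility_ge v (fun i => x i + unit_price j t i) DS.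
  by rewrite priceD price_unit (negPf jD); lra.
have st : s <= t.
  have := utility_ge v (fun i => x i + unit_price j t i) DS.
  by rewrite /s Dopt priceD price_unit jD; lra.
have : demand_within v S (fun i => x i + unit_price j s i) D.
  split=> // U US; rewrite !priceD !price_unit jD.
  have [jU|jU] := boolP (j \in U).
    by have := utility_ge v x US; rewrite Dopt; lra.
  have := utility_ge v (fun i => x i + unit_price j t i) US.
  by rewrite priceD price_unit (negPf jU) /s; lra.
case/(v_gs (p2 := fun i => p i + unit_price j s i)).
- by move=> i; apply: addr_ge0 => //; rewrite /unit_price; case: ifP => // _; exact: ltW.
- by move=> i; rewrite lerD2r.
move=> D2 /utility_demand[D2S D2opt] /(_ j jD); rewrite xpj => /(_ erefl) jD2.
have := up_drop p _ _ st; have := utility_ge v p D2S.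
by move: D2opt; rewrite priceD price_unit jD2; lra.
Qed.

(** The increase [d] is applied one item at a time, [dr s] being its part on the items of [s]. When
    an item with positive increase is raised, the two price vectors still agree on it, so
    [utility_drop_unit] applies. *)
Lemma utility_drop x p d :
  nonneg_prices x -> price_le x p -> nonneg_prices d ->
  (forall j, 0 < d j -> x j = p j) ->
  utility v S x - utility v S (fun i => x i + d i) <=
  utility v S p - utility v S (fun i => p i + d i).
Proof.
move=> x_ge0 xp d_ge0 dxp.
pose dr (s : seq Omega) i := if i \in s then d i else 0.
have dr_ge0 s i : 0 <= dr s i by rewrite /dr; case: ifP.
have drop_eq s s' y : dr s =1 dr s' ->
    utility v S (fun i => y i + dr s i) = utility v S (fun i => y i + dr s' i).
  by move=> ss'; apply: eq_utility => i _; rewrite ss'.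
suff main s : utility v S x - utility v S (fun i => x i + dr s i) <=
  utility v S p - utility v S (fun i => p i + dr s i).
  have drE y : utility v S (fun i => y i + dr (enum Omega) i) =
      utility v S (fun i => y i + d i).
    by apply: eq_utility => i _; rewrite /dr mem_enum.
  by have := main (enum Omega); rewrite !drE.
elim: s => [|j s IHs].
  have dr0 y : utility v S (fun i => y i + dr [::] i) = utility v S y.
    by apply: eq_utility => i _; rewrite /dr addr0.
  by rewrite !dr0 !subrr.
have [js|js] := boolP (j \in s).
  have drE : dr (j :: s) =1 dr s.
    by move=> i; rewrite /dr in_cons; case: (i =P j) => // ->; rewrite js.
  by rewrite !(drop_eq _ _ _ drE).
have drE (y : Omega -> R) i :
    y i + dr (j :: s) i = (y i + dr s i) + unit_price j (d j) i.
  rewrite -addrA /dr /unit_price in_cons; case: (i =P j) => [->|_] /=.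
    by rewrite (negPf js) add0r.
  by rewrite addr0.
have drU y : utility v S (fun i => y i + dr (j :: s) i) =
    utility v S (fun i => (y i + dr s i) + unit_price j (d j) i).
  by apply: eq_utility => i _; exact: drE.
rewrite !drU.
have [dj|] := eqVneq (d j) 0.
  have dj0 y : utility v S (fun i => (y i + dr s i) + unit_price j (d j) i) =
      utility v S (fun i => y i + dr s i).
    by apply: eq_utility => i _; rewrite /unit_price dj if_same addr0.
  by rewrite !dj0.
rewrite neq_lt ltNge d_ge0 /= => dj.
have := @utility_drop_unit (fun i => x i + dr s i) (fun i => p i + dr s i) j (d j).
move=> /(_ _ _ _ (ltW dj)) step.
have {}step := step _ _ _; move: step IHs.
have H1 : nonneg_prices (fun i => x i + dr s i) by move=> i; exact: addr_ge0.
have H2 : price_le (fun i => x i + dr s i) (fun i => p i + dr s i).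
  by move=> i; rewrite lerD2r.
have H3 : x j + dr s j = p j + dr s j by rewrite dxp.
by move=> /(_ H1 H2 H3); lra.
Qed.

(** The increase from the meet to [q] is positive only where the meet equals [p], so [utility_drop]
    bounds the loss by that of the same increase made at [p]. There [D] was optimal and stays
    available, so the loss is at most the increase in the price of [D]. *)
Lemma utility_meet p q D :
  nonneg_prices p -> nonneg_prices q -> demand_within v S p D ->
  utility v S (fun j => Num.min (p j) (q j)) - utility v S q <=
  price (fun j => q j - Num.min (p j) (q j)) D.
Proof.
move=> p_ge0 q_ge0 /utility_demand[DS Dopt].
have dE i : q i = Num.min (p i) (q i) + (q i - Num.min (p i) (q i)) by rewrite subrKC.
rewrite (eq_utility v (fun i _ => dE i)).
have := @utility_drop (fun j => Num.min (p j) (q j)) p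
  (fun j => q j - Num.min (p j) (q j)).
rewrite Dopt => drop; apply: le_trans (drop _ _ _ _) _ => [i|i|i|i|].
- by rewrite le_min p_ge0 q_ge0.
- by rewrite ge_min lexx.
- by rewrite subr_ge0 ge_min lexx orbT.
- by rewrite subr_gt0 gt_min ltxx orbF => /ltW; rewrite minEle => ->.
have := utility_ge v (fun i => p i + (q i - Num.min (p i) (q i))) DS.
by rewrite priceD; lra.
Qed.

End Valuation.

(** * Restricting a market to [S] by prohibitive prices *)

Definition excluding S (M : R) p j : R := if j \in S then p j else M.

Lemma price_excluding S M p T : T \subset S -> price (excluding S M p) T = price p T.
Proof. by move=> /subsetP TS; apply: price_eq => j /TS; rewrite /excluding => ->. Qed.

Lemma excluding_ge0 S M p : 0 <= M -> nonneg_prices p -> nonneg_prices (excluding S M p).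
Proof. by move=> M_ge0 p_ge0 j; rewrite /excluding; case: ifP. Qed.

Section Excluding.
Variables (v : {set Omega} -> R) (S : {set Omega}) (M : R).
Hypotheses (v0 : v set0 = 0) (v_mono : monotone_val v).

Lemma val_ge0 T : 0 <= v T.
Proof. by rewrite -v0; apply: v_mono; exact: sub0set. Qed.

Lemma excluded_price p T : nonneg_prices p -> 0 <= M -> ~~ (T \subset S) ->
  M <= price (excluding S M p) T.
Proof.
move=> p_ge0 M_ge0 /subsetPn[j jT jS]; rewrite /price (bigD1 j) //=.
rewrite {1}/excluding (negPf jS) lerDl; apply: sumr_ge0 => i _.
exact: excluding_ge0.
Qed.

Lemma demand_excluding p D : v setT <= M -> nonneg_prices p ->
  demand_within v S p D -> in_demand v (excluding S M p) D.
Proof.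
move=> vM p_ge0 [DS D_dem]; apply/forallP => U; rewrite (price_excluding _ _ DS).
have M_ge0 : 0 <= M by apply: le_trans vM; exact: val_ge0.
have [US|US] := boolP (U \subset S).
  by rewrite price_excluding //; exact: D_dem.
have := excluded_price p_ge0 M_ge0 US; have := D_dem set0 (sub0set _).
by rewrite v0 price0; have := v_mono (subsetT U); lra.
Qed.

(** Strictness matters here: a bundle leaving [S] has negative net value and loses to the empty
    bundle, whereas [M = v setT] would allow a tie. *)
Lemma excluding_demand p D : v setT < M -> nonneg_prices p ->
  in_demand v (excluding S M p) D -> demand_within v S p D.
Proof.
move=> vM p_ge0 /forallP D_dem.
have M_ge0 : 0 <= M by apply: le_trans (ltW vM); exact: val_ge0.
have DS : D \subset S.
  apply/negPn/negP => DS; have := excluded_price p_ge0 M_ge0 DS.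
  have := D_dem set0; rewrite v0 price0.
  by have := v_mono (subsetT D); lra.
by split=> // U US; have := D_dem U; rewrite !price_excluding.
Qed.

End Excluding.

Lemma gross_substitute_within v S : v set0 = 0 -> monotone_val v ->
  gross_substitute v -> substitutes_within v S.
Proof.
move=> v0 v_mono v_gs p1 p2 p1_ge0 p12 D1 D1dem.
have M_gt : v setT < v setT + 1 by rewrite ltrDl.
have M_ge0 : 0 <= v setT + 1 by rewrite addr_ge0 ?ler01 // val_ge0.
have p2_ge0 j : 0 <= p2 j by apply: le_trans (p1_ge0 j) _.
have [||D2 D2dem D12] := v_gs (excluding S (v setT + 1) p1)
    (excluding S (v setT + 1) p2) _ _ D1
    (demand_excluding v0 v_mono (ltW M_gt) p1_ge0 D1dem).
- exact: excluding_ge0.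
- by move=> j; rewrite /excluding; case: ifP.
exists D2; first exact: excluding_demand M_gt _ D2dem.
move=> j jD1 pj; apply: D12 => //.
by rewrite /excluding; case: ifP.
Qed.

End Price.

(** * Allocations and duality for the Lyapunov function *)

Section Market.
Variables (R : realType) (Omega B : finType).
Implicit Types (v : B -> {set Omega} -> R) (p q r : Omega -> R) (S T : {set Omega}).
Implicit Types (A : B -> {set Omega}).

Lemma is_allocP S A : reflect ((forall b, A b \subset S) /\
  (forall b b', b != b' -> [disjoint A b & A b'])) (is_alloc S A).
Proof.
apply: (iffP andP) => [[/forallP AS /forallP disjA]|[AS disjA]]; split=> //.
- by move=> b b'; have /forallP/(_ b')/implyP := disjA b.
- exact/forallP.
by apply/forallP => b; apply/forallP => b'; apply/implyP; exact: disjA.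
Qed.

Lemma is_allocS S T A : S \subset T -> is_alloc S A -> is_alloc T A.
Proof.
move=> ST /is_allocP[AS disjA]; apply/is_allocP; split=> // b.
exact: subset_trans ST.
Qed.

Lemma alloc_cover S A : is_alloc S A -> \bigcup_b A b \subset S.
Proof. by move=> /is_allocP[AS _]; apply/bigcupsP. Qed.

Lemma alloc_price S A p : is_alloc S A ->
  \sum_b price p (A b) = price p (\bigcup_b A b).
Proof. by move=> /is_allocP[_ disjA]; rewrite /price partition_disjoint_bigcup. Qed.

Lemma v_OR_ge v S A : is_alloc S A -> \sum_b v b (A b) <= v_OR v S.
Proof.
move=> /is_allocP[AS disjA].
have fA : is_alloc S [ffun b => A b].
  by apply/is_allocP; split=> [b|b b']; rewrite !ffunE //; exact: disjA.
apply: (bigmax_sup [ffun b => A b]) => //; apply: ler_sum => b _.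
by rewrite ffunE.
Qed.

Lemma alloc_empty S : is_alloc S (fun _ : B => set0).
Proof.
by apply/is_allocP; split=> [b|b b' _]; rewrite ?sub0set // -setI_eq0 set0I.
Qed.

Lemma v_OR_attained v S : (forall b, v b set0 = 0) -> exists A, OR_optimal v S A.
Proof.
move=> v0.
have [||f fS fopt] := @bigmax0_attained R _
    (fun f : {ffun B -> {set Omega}} => is_alloc S f)
    (fun f => \sum_b v b (f b)) [ffun=> set0].
- by apply/is_allocP; split=> [b|b b' _]; rewrite !ffunE ?sub0set // -setI_eq0 set0I.
- by rewrite big1 // => b _; rewrite ffunE v0.
by exists f; split=> //; rewrite -fopt.
Qed.

Lemma envy_freeE v S p A : envy_free v S p A <->
  is_alloc S A /\ forall b, demand_within (v b) S p (A b).
Proof.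
split=> [[/[dup] SA /is_allocP[AS _] Aef]|[SA Adem]]; split=> // b.
  by split=> //; exact: Aef.
by have [] := Adem b.
Qed.

(* Ausubel's Lyapunov function, with reserve prices r: a dual bound on surplus. *)
Definition lyapunov v S r p : R :=
  \sum_b utility (v b) S p + (price p S - price r S).

Definition welfare v r A : R := \sum_b (v b (A b) - price r (A b)).

(** Only sold items are charged their reserve, unlike in [v_OR v S - price r S], which charges all
    of [S]. *)
Definition surplus v r S : R := v_OR (fun b T => v b T - price r T) S.

Lemma welfareE v r A :
  welfare v r A = \sum_b v b (A b) - \sum_b price r (A b).
Proof. exact: sumrB. Qed.

Lemma surplus_ge v r S A : is_alloc S A -> welfare v r A <= surplus v r S.
Proof. exact: v_OR_ge. Qed.

Variable v : B -> {set Omega} -> R.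
Hypothesis v0 : forall b, v b set0 = 0.

Lemma surplus_attained r S : exists2 A, is_alloc S A & surplus v r S = welfare v r A.
Proof.
have [b|A [SA Aopt]] := @v_OR_attained (fun b T => v b T - price r T) S.
  by rewrite v0 price0 subrr.
by exists A.
Qed.

Lemma envy_free_utility S p A : envy_free v S p A ->
  \sum_b utility (v b) S p = welfare v p A.
Proof.
by move=> /envy_freeE[_ Adem]; apply: eq_bigr => b _;
   have /(utility_demand _ (v0 b))[] := Adem b.
Qed.

Lemma alloc_price_le S r p A : price_le r p -> is_alloc S A ->
  \sum_b price p (A b) - \sum_b price r (A b) <= price p S - price r S.
Proof.
move=> rp SA; rewrite !(alloc_price _ SA) -!priceB.
by apply: price_sub (alloc_cover SA) => j; rewrite subr_ge0.
Qed.

Lemma welfare_le_utility S p A : is_alloc S A ->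
  welfare v p A <= \sum_b utility (v b) S p.
Proof. by move=> /is_allocP[AS _]; apply: ler_sum => b _; exact: utility_ge. Qed.

Lemma welfare_le_lyapunov S r p A : price_le r p -> is_alloc S A ->
  welfare v r A <= lyapunov v S r p.
Proof.
move=> rp SA; have := alloc_price_le rp SA; have := welfare_le_utility p SA.
by rewrite /lyapunov !welfareE; lra.
Qed.

Lemma surplus_le_lyapunov S r p : price_le r p -> surplus v r S <= lyapunov v S r p.
Proof. by move=> rp; have [A SA ->] := surplus_attained r S; exact: welfare_le_lyapunov. Qed.

(** The Lyapunov function minus the welfare is the sum of each bidder's shortfall from her indirect
    utility and of [p - r] on the unsold items. All these terms are nonnegative, so tightness makes
    each of them vanish. *)
Lemma complementary_slackness S r p A : price_le r p -> is_alloc S A ->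
  lyapunov v S r p <= welfare v r A ->
  envy_free v S p A /\
  \sum_b price p (A b) - \sum_b price r (A b) = price p S - price r S.
Proof.
move=> rp SA; rewrite /lyapunov => tight.
have pA := alloc_price_le rp SA; have uA := welfare_le_utility p SA.
split; last by move: tight pA uA; rewrite !welfareE; lra.
apply/envy_freeE; split=> // b; apply/utility_demand => //.
have /is_allocP[AS _] := SA; split=> //.
have gap_ge0 b' : 0 <= utility (v b') S p - (v b' (A b') - price p (A b')).
  by rewrite subr_ge0 utility_ge.
apply/eqP; rewrite -subr_eq0; apply/eqP; move: b (isT : true).
apply: (psumr_eq0P (fun b' _ => gap_ge0 b')).
have : 0 <= \sum_b (utility (v b) S p - (v b (A b) - price p (A b))).
  exact: sumr_ge0.
by move: tight pA uA; rewrite sumrB !welfareE sumrB; lra.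
Qed.

Lemma lyapunov_lipschitz S r p q e : 0 <= e ->
  (forall j, q j <= p j + e) -> (forall j, p j <= q j + e) ->
  lyapunov v S r p <= lyapunov v S r q + e *+ (#|Omega| * #|B| + #|Omega|).
Proof.
move=> e_ge0 qp pq.
have : \sum_b utility (v b) S p <= \sum_b utility (v b) S q + e *+ (#|Omega| * #|B|).
  rewrite mulrnA -sumr_const -big_split; apply: ler_sum => b _.
  exact: utility_lipschitz.
have : price p S <= price q S + e *+ #|Omega|.
  apply: le_trans (price_mono (q := fun j => q j + e) _) _ => //.
  rewrite priceD lerD2l; apply: le_trans (price_sub _ (subsetT S)) _ => //.
  by rewrite /price sumr_const cardsT.
by rewrite /lyapunov mulrnDr; lra.
Qed.

Hypothesis v_mono : forall b, monotone_val (v b).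
Hypothesis v_gs : forall b, gross_substitute (v b).

(** Passing from [q] to the meet [m] raises the utilities by at most the total of [q - m] on the
    sold items, while the price term falls by the total of [q - m] on all of [S]. *)
Lemma lyapunov_meet S r p q A :
  nonneg_prices p -> nonneg_prices q -> envy_free v S p A ->
  lyapunov v S r (fun j => Num.min (p j) (q j)) <= lyapunov v S r q.
Proof.
move=> p_ge0 q_ge0 /envy_freeE[SA Adem].
set m := fun j => _.
have qm_ge0 : nonneg_prices (fun j => q j - m j).
  by move=> j; rewrite subr_ge0 ge_min lexx orbT.
have : \sum_b utility (v b) S m - \sum_b utility (v b) S q <=
    \sum_b price (fun j => q j - m j) (A b).
  rewrite -sumrB; apply: ler_sum => b _; apply: utility_meet => //.
  exact: gross_substitute_within.
have := price_sub qm_ge0 (alloc_cover SA).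
by rewrite (alloc_price _ SA) !priceB /lyapunov; lra.
Qed.

(** * The Kelso-Crawford auction and approximate equilibria *)

Section Auction.
Variables (S : {set Omega}) (r : Omega -> R) (e : R).
Hypotheses (r_ge0 : nonneg_prices r) (e_gt0 : 0 < e).

Definition bid_price (n : Omega -> nat) (A : {set Omega}) (j : Omega) : R :=
  r j + e *+ (n j + (j \notin A)).

(* The state of a Kelso-Crawford auction with increment e after n j price
   increases of item j: a bidder pays one increment more for the items she
   does not hold, and never regrets what she holds. *)
Definition auction_state (n : Omega -> nat) A : Prop :=
  [/\ is_alloc S A,
      (forall b, exists2 D, demand_within (v b) S (bid_price n (A b)) D & A b \subset D) &
      (forall j, (forall b, j \notin A b) -> n j = 0%N)].

Lemma bid_price_ge0 n T : nonneg_prices (bid_price n T).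
Proof. by move=> j; rewrite addr_ge0 // mulrn_wge0 // ltW. Qed.

(** The holder of a sold item demands a bundle containing it, and its nonnegative utility bounds the
    price by her value. Unsold items have no increases. *)
Lemma auction_bound n A j : auction_state n A -> e *+ n j <= \sum_b v b setT.
Proof.
move=> [SA Adem unsold].
have vT_ge0 b : 0 <= v b setT by exact: val_ge0.
have [/existsP[b jb]|] := boolP [exists b, j \in A b]; last first.
  rewrite negb_exists => /forallP /unsold ->.
  by rewrite mulr0n; apply: sumr_ge0.
have [D [_ Dopt] /subsetP AD] := Adem b.
have : e *+ n j <= price (bid_price n (A b)) D.
  rewrite /price (bigD1 j) ?AD //= /bid_price jb addn0.
  rewrite -[leLHS]add0r -addrA lerD // lerDl; apply: sumr_ge0 => i _.
  exact: bid_price_ge0.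
have := Dopt set0 (sub0set _); rewrite v0 price0 subrr.
have := v_mono b (subsetT D).
have : v b setT <= \sum_b v b setT.
  by rewrite [leRHS](bigD1 b) //= lerDl; apply: sumr_ge0.
lra.
Qed.

(** Bidder [b] takes a demanded bundle [D] containing her holding, and the items new to her rise by
    one increment. Her bid prices are unchanged on all items, since the surcharge becomes part of
    the price. The others' bid prices only rise, and not on the items they keep, so gross
    substitutes preserves the invariant. *)
Lemma auction_step n A b : auction_state n A ->
  ~ demand_within (v b) S (bid_price n (A b)) (A b) ->
  exists n' A', auction_state n' A' /\ (\sum_j n j < \sum_j n' j)%N.
Proof.
move=> [/is_allocP[AS disjA] Adem unsold] Ab_bad.
have [D Ddem AD] := Adem b; have [DS _] := Ddem.
have DAb : A b != D by apply: contra_not_neq Ab_bad => AbD; rewrite {2}AbD.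
pose n' j := (n j + (j \in D :\: A b))%N.
pose A' b' := if b' == b then D else A b' :\: D.
have A'b : A' b = D by rewrite /A' eqxx.
have A'N b' : b' != b -> A' b' = A b' :\: D by rewrite /A' => /negPf ->.
exists n', A'; split; last first.
  rewrite big_split /= -[ltnLHS]addn0 ltn_add2l -big_mkcond /= sum1_card.
  rewrite card_gt0 setD_eq0; apply: contra DAb => DA.
  by rewrite eqEsubset AD DA.
split.
- apply/is_allocP; split=> [b'|b1 b2 b12].
    have [->|b'b] := eqVneq b' b; first by rewrite A'b.
    by rewrite A'N //; apply: subset_trans (subsetDl _ _) (AS b').
  have [b1b|b1b] := eqVneq b1 b.
    rewrite b1b A'b A'N; last by rewrite -b1b eq_sym.
    by rewrite -setI_eq0 setIDA setDIl setDv set0I.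
  have [b2b|b2b] := eqVneq b2 b.
    by rewrite b2b A'b A'N // -setI_eq0 setIC setIDA setDIl setDv set0I.
  rewrite !A'N // -setI_eq0 -subset0; have := disjA _ _ b12.
  by rewrite -setI_eq0 => /eqP <-; apply: setISS; exact: subsetDl.
- move=> b'; have [->|b'b] := eqVneq b' b.
    exists D; rewrite A'b //; suff : bid_price n' D =1 bid_price n (A b).
      move=> bidE; split=> // U US.
      by rewrite !(price_eq (fun j _ => bidE j)); have [_] := Ddem; exact.
    move=> j; rewrite /bid_price /n' inE; have := subsetP AD j.
    by case: (j \in A b) => [->|_] //=; case: (j \in D) => /=; rewrite ?addn0.
  have [D1 D1dem AD1] := Adem b'.
  have [||D2 D2dem D12] := gross_substitute_within (v0 b') (@v_mono b')
    (@v_gs b') (p2 := bid_price n' (A' b')) _ _ D1dem.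
  + exact: bid_price_ge0.
  + move=> j; rewrite /bid_price lerD2l ler_wpMn2l ?(ltW e_gt0) //.
    rewrite /n' A'N // !inE -addnA leq_add2l.
    by case: (j \in A b'); case: (j \in D); case: (j \in A b).
  exists D2 => //; rewrite A'N //; apply/subsetP => j /setDP[jA jD].
  apply: D12; first exact: (subsetP AD1).
  by rewrite /bid_price /n' A'N // !inE (negPf jD) jA /= andbF !addn0.
- move=> j jA'; have jD : j \notin D by have := jA' b; rewrite A'b.
  rewrite /n' !inE (negPf jD) andbF addn0; apply: unsold => b'.
  have [->|b'b] := eqVneq b' b; first by apply: contra jD; exact: subsetP.
  by have := jA' b'; rewrite A'N // inE (negPf jD).
Qed.

Lemma auction_ends : exists n A, auction_state n A /\
  forall b, demand_within (v b) S (bid_price n (A b)) (A b).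
Proof.
have [K MK] : exists K, \sum_b v b setT < e *+ K.
  have M_ge0 : 0 <= \sum_b v b setT by apply: sumr_ge0 => b _; exact: val_ge0.
  exists (Num.bound ((\sum_b v b setT) / e)).
  rewrite -mulr_natl -ltr_pdivrMr //; apply: archi_boundP.
  by rewrite divr_ge0 // ltW.
have bound n A : auction_state n A -> (\sum_j n j <= #|Omega| * K)%N.
  move=> nA; rewrite -sum_nat_const; apply: leq_sum => j _.
  rewrite leqNgt; apply/negP => Kn; have := auction_bound j nA.
  apply/negP; rewrite -ltNge; apply: lt_le_trans MK _.
  by rewrite ler_wpMn2l ?(ltW e_gt0) // ltnW.
have start : auction_state (fun=> 0%N) (fun=> set0).
  split=> // [|b]; first exact: alloc_empty.
  have [D Ddem] := demand_exists S (v0 b) (bid_price (fun=> 0%N) set0).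
  by exists D => //; exact: sub0set.
(* [k] is fuel: a step spends one unit but adds at least one price increase, so the sum stays above
   the bound on the number of increases, which is absurd at [k = 0]. *)
suff loop k n A : auction_state n A -> (#|Omega| * K < \sum_j n j + k)%N ->
    exists n A, auction_state n A /\
      forall b, demand_within (v b) S (bid_price n (A b)) (A b).
  by apply: (loop (#|Omega| * K).+1 _ _ start); rewrite ltn_addl.
elim: k n A => [|k IHk] n A nA; first by rewrite addn0 ltnNge (bound _ _ nA).
move=> nk.
have [Adem|] := pselect (forall b, demand_within (v b) S (bid_price n (A b)) (A b)).
  by exists n, A.
move=> /existsNP[b /(auction_step nA)[n' [A' [nA' nn']]]].
by apply: IHk nA' _; apply: leq_trans nk _; rewrite addnS -addSn leq_add2r.
Qed.

(** Dropping the surcharges gives public prices [q]. Bid prices exceed [q] by at most [e] per item,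
    which costs each bidder at most [e] times the number of items. Unsold items stay at their
    reserve and contribute no slack. *)
Lemma approximate_equilibrium : exists2 q, price_le r q &
  lyapunov v S r q <= surplus v r S + e *+ (#|Omega| * #|B|).
Proof.
have [n [A [[SA _ unsold] Adem]]] := auction_ends.
pose q j := r j + e *+ n j.
have rq : price_le r q by move=> j; rewrite lerDl mulrn_wge0 // ltW.
exists q => //.
have welf : \sum_b utility (v b) S q <= welfare v q A + e *+ (#|Omega| * #|B|).
  rewrite mulrnA -sumr_const -big_split; apply: ler_sum => b _.
  have /utility_demand-/(_ (v0 b))[_ Aopt] := Adem b.
  have -> : price q (A b) = price (bid_price n (A b)) (A b).
    by apply: price_eq => j jA; rewrite /bid_price jA addn0.
  rewrite -Aopt; apply: utility_lipschitz => //; first exact: ltW.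
  move=> j; rewrite /bid_price /q -addrA lerD2l -mulrSr ler_wpMn2l ?(ltW e_gt0) //.
  by rewrite -addn1 leq_add2l; case: (j \notin A b).
have slack : price q S - price r S = \sum_b price q (A b) - \sum_b price r (A b).
  rewrite !(alloc_price _ SA) -!priceB {1}/price (big_setID (\bigcup_b A b)) /=.
  rewrite (setIidPr (alloc_cover SA)) [X in _ + X]big1 ?addr0 // => j /setDP[_ jA].
  rewrite /q unsold ?mulr0n ?addr0 ?subrr // => b.
  by apply: contra jA => jA; apply/bigcupP; exists b.
have := surplus_ge v r SA; move: welf.
by rewrite /lyapunov slack !welfareE; lra.
Qed.

End Auction.

(** * Tight prices below envy-free prices *)

Lemma exact_equilibrium S r p A :
  nonneg_prices r -> price_le r p -> envy_free v S p A ->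
  exists y, [/\ price_le r y, price_le y p & lyapunov v S r y <= surplus v r S].
Proof.
move=> r_ge0 rp p_ef.
have [|//|y ybox y_min] :=
  @lipschitz_box_min R Omega (lyapunov v S r) (#|Omega| * #|B| + #|Omega|)%N r p.
  by move=> e x y; exact: lyapunov_lipschitz.
exists y; split=> [j|j|]; try by have /andP[] := ybox j.
(* The meet of [p] with approximate equilibrium prices [q] lies in the box, so the minimizer [y] is
   within every [e] of the surplus. *)
apply/ler_addgt0Pr => e e_gt0.
pose d := e / (#|Omega| * #|B|).+1%:R.
have d_gt0 : 0 < d by rewrite divr_gt0.
have dN : d *+ (#|Omega| * #|B|) <= e.
  have -> : e = d *+ (#|Omega| * #|B|).+1 by rewrite -mulr_natr divfK ?pnatr_eq0.
  exact: (ler_wpMn2l (ltW d_gt0) (leqnSn _)).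
have [q rq q_eq] := approximate_equilibrium S r_ge0 d_gt0.
have p_ge0 : nonneg_prices p by move=> j; apply: le_trans (rp j).
have q_ge0 : nonneg_prices q by move=> j; apply: le_trans (rq j).
have := lyapunov_meet r p_ge0 q_ge0 p_ef.
have : lyapunov v S r y <= lyapunov v S r (fun j => Num.min (p j) (q j)).
  by apply: y_min => j; rewrite le_min rp rq ge_min lexx.
by move: dN q_eq; lra.
Qed.

Lemma tight_envy_free S r p : price_le r p ->
  lyapunov v S r p <= surplus v r S -> has_ef_alloc v S p.
Proof.
move=> rp tight; have [A SA Aopt] := surplus_attained r S.
by exists A; apply: (proj1 (complementary_slackness rp SA _)); rewrite -Aopt.
Qed.

Lemma virtual_auction_tight S r p A : nonneg_prices r ->
  virtual_auction v r S p A -> lyapunov v S r p <= surplus v r S.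
Proof.
move=> r_ge0 [rp _ p_min _ [p_ef _]].
have [y [ry yp y_tight]] := exact_equilibrium r_ge0 rp p_ef.
by rewrite -(p_min y) //; exact: tight_envy_free y_tight.
Qed.

(** * The mediator's demand and the OR-player's demand *)

Section Mediator.
Variables (r : Omega -> R).
Hypothesis r_ge0 : nonneg_prices r.

(** Take exactly the items sold by an allocation of maximal surplus: no reserve is then paid for an
    unsold item. *)
Lemma OR_demand_exists : exists S, surplus v r setT <= v_OR v S - price r S.
Proof.
have [A TA ->] := surplus_attained r setT; exists (\bigcup_b A b).
have /is_allocP[_ disjA] := TA.
rewrite welfareE (alloc_price _ TA) lerD2r; apply: v_OR_ge.
by apply/is_allocP; split=> // b; exact: bigcup_sup.
Qed.

Lemma OR_demandE S :
  OR_demand v r S <-> surplus v r setT <= v_OR v S - price r S.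
Proof.
split=> [S_dem|S_opt T].
  by have [T T_opt] := OR_demand_exists; exact: le_trans T_opt (S_dem T).
apply: le_trans S_opt; have [A [TA <-]] := v_OR_attained T v0.
apply: le_trans (surplus_ge v r (is_allocS (subsetT T) TA)).
rewrite welfareE (alloc_price _ TA) lerD2l lerN2.
exact: price_sub (alloc_cover TA).
Qed.

Variables (pS : {set Omega} -> Omega -> R) (AS : {set Omega} -> B -> {set Omega}).
Hypothesis hva : forall S, virtual_auction v r S (pS S) (AS S).

Let y := pS setT.

Lemma reserve_le S : price_le r (pS S).
Proof. by have [] := hva S. Qed.

Lemma auction_price_ge0 S : nonneg_prices (pS S).
Proof. by move=> j; apply: le_trans (reserve_le S j). Qed.

(* The auction prices for S, made prohibitive outside S, are envy free on all
   items; their meet with y is then tight too, so it is y by minimality. *)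
Lemma full_price_le S j : j \in S -> y j <= pS S j.
Proof.
move=> jS; have [_ _ _ _ [/envy_freeE[SA Adem] _]] := hva S.
have [ry _ y_min _ _] := hva setT.
(* [M] dominates every valuation, which makes it prohibitive, and every reserve, which keeps [p]
   above [r]. *)
pose M := \sum_b v b setT + price r setT.
have vT_ge0 b : 0 <= v b setT by exact: val_ge0.
have rM i : r i <= M.
  rewrite -[leLHS]add0r lerD ?sumr_ge0 // /price (bigD1 i) //= lerDl.
  exact: sumr_ge0.
have vM b : v b setT <= M.
  rewrite -[leLHS]addr0 lerD ?price_ge0 // (bigD1 b) //= lerDl.
  exact: sumr_ge0.
pose p := excluding S M (pS S).
have p_ef : envy_free v setT p (AS S).
  apply/envy_freeE; split=> [|b]; first exact: is_allocS (subsetT S) SA.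
  apply/in_demandP; apply: demand_excluding => //; exact: auction_price_ge0.
have rp : price_le r p.
  by move=> i; rewrite /p /excluding; case: ifP => _ //; exact: reserve_le.
have p_ge0 : nonneg_prices p by move=> i; apply: le_trans (rp i).
pose m i := Num.min (p i) (y i).
have rm : price_le r m by move=> i; rewrite le_min rp ry.
have m_tight : lyapunov v setT r m <= surplus v r setT.
  apply: le_trans (virtual_auction_tight r_ge0 (hva setT)).
  by apply: lyapunov_meet p_ef => //; exact: auction_price_ge0.
have : m = y.
  apply: y_min => //; last exact: tight_envy_free m_tight.
  by move=> i; rewrite ge_min lexx orbT.
move=> /(congr1 (fun f => f j)); rewrite /m /p /excluding jS => <-.
by rewrite ge_min lexx.
Qed.

Lemma price_outside S p q : (forall j, j \notin S -> p j = q j) ->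
  price p setT - price q setT = price p S - price q S.
Proof.
move=> pq; rewrite -!priceB /price (big_setID S) /= setTI.
by rewrite [X in _ + X]big1 ?addr0 // => j /setDP[_ jS]; rewrite pq ?subrr.
Qed.

Lemma full_surplus_alloc S A : is_alloc S A ->
  surplus v r setT <= welfare v r A ->
  [/\ envy_free v setT y A, pS S = y &
      \sum_b price y (A b) - \sum_b price r (A b) = price y S - price r S].
Proof.
move=> SA A_opt; have [ry _ _ _ _] := hva setT.
have TA := is_allocS (subsetT S) SA.
have [y_ef y_rev] := complementary_slackness ry TA
  (le_trans (virtual_auction_tight r_ge0 (hva setT)) A_opt).
(* The items sold by [A] lie in [S] and already account for the whole excess of [y] over [r], so
   none remains outside. *)
have y_out j : j \notin S -> y j = r j.
  move=> jS; apply/eqP; rewrite -subr_eq0; apply/eqP.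
  have yr_ge0 i : 0 <= y i - r i by rewrite subr_ge0.
  have : price (fun j => y j - r j) (~: S) = 0.
    apply/eqP; rewrite eq_le price_ge0 // andbT.
    have := alloc_price_le ry SA; rewrite y_rev -!priceB.
    rewrite {1}/price (big_setID S) /= setTI -setTD -!/(price _ _).
    by rewrite -[leRHS]addr0 lerD2l.
  by move/psumr_eq0P; apply; rewrite // inE.
split=> //; last by rewrite y_rev; exact: price_outside.
(* [y] is below [pS S] and envy free on [S], so minimality of [pS S] forces equality. *)
have [_ _ S_min S_out _] := hva S; apply/esym/S_min => //.
  move=> j; have [jS|jS] := boolP (j \in S); first exact: full_price_le.
  by rewrite y_out // S_out.
exists A; split=> // b U US; have [_] := y_ef; apply; exact: subsetT.
Qed.

Lemma full_surplus_price S : surplus v r setT <= surplus v r S ->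
  pS S = y /\ price y setT - price r setT = price y S - price r S.
Proof.
have [A SA ->] := surplus_attained r S => A_opt.
have [_ pSy _] := full_surplus_alloc SA A_opt; split=> //.
apply: price_outside => j jS; rewrite -pSy.
by have [_ _ _ ->] := hva S.
Qed.

Lemma auction_revenue_le S A : is_alloc S A -> \sum_b price y (A b) <= price y S.
Proof.
move=> SA; rewrite (alloc_price _ SA); apply: price_sub (alloc_cover SA).
exact: auction_price_ge0.
Qed.

(* Items outside S cost their reserve, so they leave the Lyapunov function at
   pS S unchanged when the market grows from S to all items. *)
Lemma in_demand_surplus S : (forall b, in_demand (v b) (pS S) (AS S b)) ->
  surplus v r setT <= surplus v r S.
Proof.
move=> A_dem; have [rp _ _ p_out [p_ef _]] := hva S.
apply: le_trans (virtual_auction_tight r_ge0 (hva S)).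
apply: le_trans (surplus_le_lyapunov setT rp) _.
rewrite /lyapunov (price_outside p_out) lerD2r.
rewrite (envy_free_utility p_ef) (@envy_free_utility setT _ (AS S)) //.
apply/envy_freeE; split=> [|b]; last exact/in_demandP.
by have [SA _] := p_ef; exact: is_allocS (subsetT S) SA.
Qed.

Let top_revenue := price y setT - price r setT.

Lemma top_revenue_ge0 : 0 <= top_revenue.
Proof. by rewrite subr_ge0; apply: price_mono => j _; exact: reserve_le. Qed.

Lemma revenue_le S : revenue v r S (pS S) (AS S) <= top_revenue.
Proof.
rewrite /revenue; case: ifP => [/forallP A_dem|_]; last first.
  by apply: le_trans top_revenue_ge0; rewrite lerN10.
have [pSy top_eq] := full_surplus_price (in_demand_surplus A_dem).
rewrite /top_revenue top_eq pSy lerD2r; apply: auction_revenue_le.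
by have [_ _ _ _ [[]]] := hva S.
Qed.

Section OptimalSet.
Variable S : {set Omega}.
Hypothesis S_opt : surplus v r setT <= v_OR v S - price r S.

Lemma OR_optimal_auction A : OR_optimal v S A ->
  [/\ virtual_auction v r S (pS S) A, pS S = y,
      \sum_b price y (A b) = price y S & revenue v r S (pS S) A = top_revenue].
Proof.
move=> [SA A_opt].
have rA : \sum_b price r (A b) <= price r S.
  by rewrite (alloc_price _ SA); exact: price_sub (alloc_cover SA).
have A_surplus : surplus v r setT <= welfare v r A.
  by apply: le_trans S_opt _; rewrite welfareE A_opt lerD2l lerN2.
(* Were a positive reserve left unsold in [S], the welfare of [A] would exceed the surplus of the
   whole market. *)
have rAE : \sum_b price r (A b) = price r S.
  apply/eqP; rewrite eq_le rA /=.
  have := surplus_ge v r (is_allocS (subsetT S) SA).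
  by move: S_opt; rewrite welfareE A_opt; lra.
have [y_ef pSy] := full_surplus_alloc SA A_surplus.
rewrite rAE => /addIr yA.
have [_ top_eq] := full_surplus_price (le_trans A_surplus (surplus_ge v r SA)).
have [rp p_has p_min p_out _] := hva S.
split=> //.
  split=> //; split=> [|A' [SA' _]]; last by rewrite pSy yA; exact: auction_revenue_le.
  by split=> // b U US; rewrite pSy; have [_] := y_ef; apply; exact: subsetT.
rewrite /revenue pSy yA ifT // /top_revenue ?top_eq //.
by apply/forallP => b; apply/in_demandP; have /envy_freeE[_] := y_ef; exact.
Qed.

(** At [y], [AS S] and an OR-optimal allocation are both envy free, hence have equal total utility.
    The latter sells for all of [y(S)], so by revenue maximality [AS S] does too, and the total
    values agree. *)
Lemma auction_OR_optimal : OR_optimal v S (AS S).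
Proof.
have [A A_opt] := v_OR_attained S v0.
have [[_ _ _ _ [A_ef _]] pSy yA _] := OR_optimal_auction A_opt.
have [_ _ _ _ [AS_ef AS_max]] := hva S.
have [SAS _] := AS_ef; split=> //; have [_ <-] := A_opt.
have := AS_max A A_ef; have := auction_revenue_le SAS; rewrite pSy yA.
have := envy_free_utility A_ef; rewrite (envy_free_utility AS_ef) !welfareE pSy yA.
by lra.
Qed.

End OptimalSet.

Lemma mediator_demandE S :
  mediator_demand v r pS AS S <-> surplus v r setT <= v_OR v S - price r S.
Proof.
split=> [S_dem|S_opt T]; last first.
  have [_ _ _ ->] := OR_optimal_auction S_opt (auction_OR_optimal S_opt).
  exact: revenue_le.
have [S0 S0_opt] := OR_demand_exists.
have := S_dem S0.
have [_ _ _ ->] := OR_optimal_auction S0_opt (auction_OR_optimal S0_opt).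
(* The revenue of [S] is at least [top_revenue], which is nonnegative, so it is not the default
   -1. *)
rewrite /revenue; case: ifP => [/forallP A_dem|_]; last first.
  by have := top_revenue_ge0; lra.
have S_surplus := in_demand_surplus A_dem.
have [pSy top_eq] := full_surplus_price S_surplus.
have [rp _ _ _ [p_ef _]] := hva S; have [SA _] := p_ef.
(* Revenue at least [top_revenue] means that [AS S] sells for at least [y(S)]. The price terms of
   the Lyapunov function then leave at most the value of [AS S] minus [r(S)], which bounds the
   surplus. *)
have := surplus_le_lyapunov S rp; have := v_OR_ge v SA.
rewrite /lyapunov (envy_free_utility p_ef) welfareE /top_revenue top_eq pSy.
by move: S_surplus; lra.
Qed.

End Mediator.
End Market.

Theorem theorem3 (R : realType) (Omega B : finType)
    (v : B -> {set Omega} -> R)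
    (v_mono : forall b, monotone_val (v b))
    (v_empty : forall b, v b set0 = 0)
    (v_gs : forall b, gross_substitute (v b))
    (r : Omega -> R) (r_ge0 : nonneg_prices r)
    (pS : {set Omega} -> Omega -> R) (AS : {set Omega} -> B -> {set Omega})
    (hva : forall S, virtual_auction v r S (pS S) (AS S)) :
  (forall S, mediator_demand v r pS AS S <-> OR_demand v r S) /\
  (forall S, OR_demand v r S -> OR_optimal v S (AS S)) /\
  (forall S, OR_demand v r S -> forall A, OR_optimal v S A ->
     virtual_auction v r S (pS S) A /\
     (forall T, revenue v r T (pS T) (AS T) <= revenue v r S (pS S) A)).
Proof.
split; [|split] => S.
- by split=> [/(mediator_demandE v_empty v_mono v_gs r_ge0 hva)/(OR_demandE v_empty r_ge0)
             |/(OR_demandE v_empty r_ge0)/(mediator_demandE v_empty v_mono v_gs r_ge0 hva)].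
- by move=> /(OR_demandE v_empty r_ge0); exact: auction_OR_optimal.
move=> /(OR_demandE v_empty r_ge0) S_opt A A_opt.
have [A_va _ _ A_rev] := OR_optimal_auction v_empty v_mono v_gs r_ge0 hva S_opt A_opt.
by split=> // T; rewrite A_rev; exact: revenue_le.
Qed.
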